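(* Let $n\in\mathbb{N}$, let $\alpha_i>0$ and $x_i>0$ ($i=1,\ldots,n$) be real numbers with $\sum_{i=1}^n\alpha_i=1$, and suppose that the $x_i$ are not all equal. Let $$h=\Big(\sum_{i=1}^n\frac{\alpha_i}{x_i}\Big)^{-1},\qquad g=\prod_{i=1}^n x_i^{\alpha_i},\qquad a=\sum_{i=1}^n\alpha_i x_i,\qquad \alpha=\min_i\{\alpha_i\}.$$ Then $$a\cdot\left(\alpha e\left(\frac{a}{g}\right)^{1/\alpha}+1\right)^{-1}<h\le g\le a<h\cdot\left(\alpha e\left(\frac{g}{h}\right)^{1/\alpha}+1\right),$$ and $$h\cdot\left(\frac{h}{a}\exp\left(\frac{h}{a}+\frac{n}{n-1}\right)\right)^{-\alpha}<g<a\cdot\left(\frac{h}{a}\exp\left(\frac{h}{a}+\frac{n}{n-1}\right)\right)^{\alpha}.$$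
   Context: The quantities $h$, $g$, $a$ are the weighted harmonic, geometric and arithmetic means of the $x_i$ with weights $\alpha_i$; $e=\exp(1)$. Since the $x_i$ are not all equal, $n\ge 2$. *)

(* Defs.v *)
From mathcomp Require Import all_boot all_order all_algebra.
From mathcomp Require Import all_classical all_reals all_analysis.
Set Implicit Arguments.
Unset Strict Implicit.
Unset Printing Implicit Defensive.
Import Order.TTheory GRing.Theory Num.Theory.
Local Open Scope ring_scope.

Definition weighted_harmonic_mean (R : realType) (n : nat) (alpha x : 'I_n -> R) : R :=
  (\sum_(i < n) alpha i / x i)^-1.

Definition weighted_geometric_mean (R : realType) (n : nat) (alpha x : 'I_n -> R) : R :=
  \prod_(i < n) x i `^ alpha i.

Definition weighted_arithmetic_mean (R : realType) (n : nat) (alpha x : 'I_n -> R) : R :=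
  \sum_(i < n) alpha i * x i.

(* The default value 1 never affects the result for positive weights summing
   to 1: the family is then nonempty and every weight is at most 1. *)
Definition min_weight (R : realType) (n : nat) (alpha : 'I_n -> R) : R :=
  \big[Num.min/1]_(i < n) alpha i.

(* Main.v *)
Require Import Defs.
From mathcomp Require Import all_boot all_order all_algebra.
From mathcomp Require Import all_classical all_reals all_analysis.
From mathcomp Require Import ring lra zify.
Set Implicit Arguments.
Unset Strict Implicit.
Unset Printing Implicit Defensive.
Import Order.TTheory GRing.Theory Num.Theory.
Local Open Scope ring_scope.

(** Why the theorem holds.  Put [u_i = x_i / a], so that the weighted mean of
    the [u_i] is [1], the weighted mean of the [1 / u_i] is [a / h], and
    [prod_i u_i ^ alpha_i = g / a].  With [c] a lower bound of the weights and
    [p_i = alpha_i / c >= 1], consider the two nonnegative gap functions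
      [k(u) = u + 1/u - 2 = (1 - u)^2 / u]   and   [f(u) = u - 1 - ln u].
    Since [sum_i p_i (u_i - 1) = 0], their weighted sums are
      [sum_i p_i k(u_i) = (a / h - 1) / c],
      [sum_i p_i f(u_i) = ln ((a / g) ^ (1 / c))],
    so the mean normalisation can from now on be forgotten and the first chain
    of inequalities becomes a comparison of two sums of one-variable functions.

    In one variable [1 + k(u) / e <= exp (f u)], which is the inequality
    [e u + (1 - u)^2 <= exp u] for [u >= 0] ([expR_ge_linear_add_sqr],
    [ge1D_expR_gap]).  Such a bound survives multiplication of both gaps by
    [p >= 1], by Bernoulli ([expR_bernoulli]), and summation, because
    [1 + s + t <= (1 + s) (1 + t)] ([ge1D_expR_sum]).  Hence
      [1 + (a / h - 1) / (c e) <= (a / g) ^ (1 / c)],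
    and dropping the [1] gives the strict inequality
    [a / h < c e (a / g) ^ (1 / c) + 1] ([arithmetic_harmonic_ratio_lt]).

    The exponential bounds on [g] follow from it.  Not all [x_i] being equal
    forces two indices, so the least weight is at most [1/2]; as
    [(a / g) ^ (1 / c) >= 1] and [e >= 2], the right-hand side is then at most
    [(a / g) ^ (1 / c) e], and [e] is below the exponential in the statement
    because [n / (n - 1) >= 1] ([geometric_lt_arithmetic_mean]).

    Replacing [x] by [1 / x] exchanges [(h, g, a)] with [(1/a, 1/g, 1/h)] and
    keeps [h / a], which yields the other half of each chain. *)

(** * Inequalities for the exponential *)

Lemma expR1_ge2 (R : realType) : 2 <= expR 1 :> R.
Proof. by have := expR_ge1Dx (1 : R); rewrite -natr1. Qed.

(** Equality holds at both [0] and [1].  The proof follows the quotient [B] of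
    the two sides, whose derivative is [exp (- v)] times a quadratic with roots
    [3 - e] and [1]: [B] decreases from [B 0 = 1], then increases to its second
    maximum [B 1 = 1], and decreases afterwards. *)
Lemma expR_ge_linear_add_sqr (R : realType) (u : R) :
  0 <= u -> expR 1 * u + (1 - u) ^+ 2 <= expR u.
Proof.
move=> u0; pose e := expR 1 : R; have e2 : 2 <= e := expR1_ge2 R.
pose B v : R := (e * v + (1 - v) ^+ 2) * expR (- v).
pose dB v : R := (1 - v) * (v - (3 - e)) * expR (- v).
have dBE (v : R) : is_derive v 1 B (dB v).
  apply: is_derive_eq; rewrite /dB /GRing.scale /=.
  by ring.
have mvt (v w : R) : v <= w ->
    exists2 c, v <= c <= w & B w - B v = dB c * (w - v).
  move=> vw; have [|c] := @MVT_segment R B dB v w vw (fun z _ => dBE z).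
    apply: derivable_within_continuous => z _.
    exact: (@ex_derive _ _ _ _ _ _ _ (dBE z)).
  by rewrite in_itv /=; exists c.
suff Bu : B u <= 1.
  have := ler_wpM2r (expR_ge0 u) Bu.
  by rewrite /B -mulrA -expRD addNr expR0 mulr1 mul1r.
have B0 : B 0 = 1 by rewrite /B oppr0 expR0; ring.
have B1 : B 1 = 1.
  by rewrite /B subrr expr0n addr0 mulr1 -expRD subrr expR0.
have [u1|/ltW u1] := leP 1 u.
  have [c /andP[c1 c2]] := mvt _ _ u1.
  rewrite B1 => Bc; rewrite -subr_le0 Bc.
  have := expR_gt0 (- c); rewrite /dB; set E := expR _ => E0.
  have : 0 <= (c - 1) * (c - (3 - e)) * E * (u - 1).
    by rewrite !mulr_ge0 ?(ltW E0)//; lra.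
  by lra.
have [ue|/ltW ue] := leP u (3 - e).
  have [c /andP[c1 c2]] := mvt _ _ u0.
  rewrite B0 => Bc; rewrite -subr_le0 Bc.
  have := expR_gt0 (- c); rewrite /dB; set E := expR _ => E0.
  have : 0 <= (1 - c) * ((3 - e) - c) * E * (u - 0).
    by rewrite !mulr_ge0 ?(ltW E0)//; lra.
  by lra.
have [c /andP[c1 c2]] := mvt _ _ u1.
rewrite B1 -subr_ge0 => ->; rewrite !mulr_ge0 ?expR_ge0//; lra.
Qed.

(** Comparison of the gap of the harmonic mean with that of the geometric mean.
    The constant [e] comes from [u -> 0], where both sides are equivalent to
    [1 / (e u)]. *)
Lemma ge1D_expR_gap (R : realType) (u : R) : 0 < u ->
  1 + (u + u^-1 - 2) / expR 1 <= expR (u - 1 - ln u).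
Proof.
move=> u0; have := expR_ge_linear_add_sqr (ltW u0).
rewrite !expRB lnK ?posrE//; set e := expR 1; set E := expR u => H.
have e0 : 0 < e := expR_gt0 1.
rewrite -mulrA -invfM ler_pdivlMr ?mulr_gt0//.
rewrite [X in X <= _](_ : _ = e * u + (1 - u) ^+ 2)//.
by field; rewrite !gt_eqF.
Qed.

(** Bernoulli's inequality for a real exponent, with [1 + y] relaxed to a lower
    bound of [expR f].  Only the part [(p - 1) f] of the exponent is linearised,
    with [f >= y / (1 + y)]; the product then collapses to [1 + p y]. *)
Lemma expR_bernoulli (R : realType) (p y f : R) : 1 <= p -> 0 <= y ->
  1 + y <= expR f -> 1 + p * y <= expR (p * f).
Proof.
move=> p1 y0 yf; have y1 : 0 < 1 + y by lra.
(* From [1 - f <= expR (- f)], which avoids taking a logarithm of [1 + y]. *)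
have fy : y / (1 + y) <= f.
  have : expR (- f) <= (1 + y)^-1.
    by rewrite expRN lef_pV2 ?posrE ?expR_gt0.
  have -> : y / (1 + y) = 1 - (1 + y)^-1 by field; rewrite gt_eqF.
  have := expR_ge1Dx (- f); lra.
rewrite [p * f](_ : _ = f + (p - 1) * f); last by ring.
rewrite expRD.
have -> : 1 + p * y = (1 + y) * (1 + (p - 1) * (y / (1 + y))).
  by field; rewrite gt_eqF.
have yy : 0 <= y / (1 + y) by rewrite divr_ge0// ltW.
apply: ler_pM => //; first exact: ltW.
  by rewrite addr_ge0// mulr_ge0//; lra.
apply: le_trans (expR_ge1Dx _); rewrite lerD2l ler_wpM2l//; lra.
Qed.

Lemma ge1D_expR_sum (R : realType) (I : finType) (p y f : I -> R) :
  (forall i, 1 <= p i) -> (forall i, 0 <= y i) ->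
  (forall i, 1 + y i <= expR (f i)) ->
  1 + \sum_i p i * y i <= expR (\sum_i p i * f i).
Proof.
move=> p1 y0 yf; have py i : 0 <= p i * y i by rewrite mulr_ge0// (le_trans ler01).
suff [] : 0 <= \sum_i p i * y i /\
    1 + \sum_i p i * y i <= expR (\sum_i p i * f i) by [].
elim/big_ind2 : _ => [|S1 F1 S2 F2 [S10 H1] [S20 H2]|i _].
- by rewrite addr0 expR0.
- split; first exact: addr_ge0.
  rewrite expRD; have := ler_pM (addr_ge0 ler01 S10) (addr_ge0 ler01 S20) H1 H2.
  by apply: le_trans; have := mulr_ge0 S10 S20; lra.
- by split=> //; exact: expR_bernoulli.
Qed.

(** * The three means and their logarithmic gaps *)

Section means.
Context (R : realType) (n : nat) (alpha x : 'I_n -> R).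
Hypotheses (alpha_gt0 : forall i, 0 < alpha i) (x_gt0 : forall i, 0 < x i).
Hypothesis sum_alpha : \sum_(i < n) alpha i = 1.

Local Notation h := (weighted_harmonic_mean alpha x).
Local Notation g := (weighted_geometric_mean alpha x).
Local Notation a := (weighted_arithmetic_mean alpha x).

Lemma weighted_sum_gt0 (y : 'I_n -> R) :
  (forall i, 0 < y i) -> 0 < \sum_(i < n) alpha i * y i.
Proof.
move=> y0; rewrite lt_neqAle eq_sym sumr_ge0 ?andbT; last first.
  by move=> i _; rewrite ltW// mulr_gt0.
rewrite psumr_neq0; last by move=> i _; rewrite ltW// mulr_gt0.
suff [i _] : exists i : 'I_n, true.
  by apply/hasP; exists i; rewrite ?mem_index_enum// mulr_gt0.
case: n alpha sum_alpha => [al|m al _]; last by exists ord0.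
by rewrite big_ord0 => /esym/eqP; rewrite oner_eq0.
Qed.

Lemma weighted_arithmetic_mean_gt0 : 0 < a.
Proof. exact: weighted_sum_gt0. Qed.

Lemma weighted_harmonic_mean_gt0 : 0 < h.
Proof. by rewrite invr_gt0 weighted_sum_gt0// => i; rewrite invr_gt0. Qed.

Lemma weighted_geometric_meanE : g = expR (\sum_(i < n) alpha i * ln (x i)).
Proof. by rewrite expR_sum; apply: eq_bigr => i _; rewrite /powR gt_eqF. Qed.

Lemma weighted_geometric_mean_gt0 : 0 < g.
Proof. by rewrite weighted_geometric_meanE expR_gt0. Qed.

Lemma sum_weighted_log_ratio :
  \sum_(i < n) alpha i * ln (x i / a) = ln (g / a).
Proof.
have a0 := weighted_arithmetic_mean_gt0.
rewrite ln_div ?posrE ?weighted_geometric_mean_gt0//.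
rewrite weighted_geometric_meanE expRK.
rewrite -[X in _ = _ - X]mul1r -sum_alpha mulr_suml -sumrB.
by apply: eq_bigr => i _; rewrite ln_div ?posrE// mulrBr.
Qed.

Lemma sum_weighted_ratio : \sum_(i < n) alpha i * (x i / a) = 1.
Proof.
under eq_bigr do rewrite mulrA.
by rewrite -mulr_suml divff// gt_eqF// weighted_arithmetic_mean_gt0.
Qed.

Lemma sum_weighted_inv_ratio : \sum_(i < n) alpha i * (x i / a)^-1 = a / h.
Proof.
rewrite invrK mulr_sumr; apply: eq_bigr => i _.
by rewrite invf_div; ring.
Qed.

Lemma weighted_geometric_le_arithmetic_mean : g <= a.
Proof.
have a0 := weighted_arithmetic_mean_gt0; have g0 := weighted_geometric_mean_gt0.
rewrite -[leRHS]mul1r -ler_pdivrMr//.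
rewrite -[_ / _]lnK ?posrE ?divr_gt0// expR_le1 -sum_weighted_log_ratio.
rewrite [leRHS](_ : 0 = \sum_(i < n) (alpha i * (x i / a) - alpha i)); last first.
  by rewrite sumrB sum_weighted_ratio sum_alpha subrr.
apply: ler_sum => i _; rewrite -[X in _ <= _ - X]mulr1 -mulrBr.
rewrite ler_wpM2l ?(ltW (alpha_gt0 i))//.
have := @le_ln1Dx R (x i / a - 1); rewrite subrKC; apply.
by rewrite ltrBrDl subrr divr_gt0.
Qed.

(** The core estimate, obtained by summing the one-variable comparison with
    multiplicities [alpha i / c]; these are at least [1] exactly because [c]
    bounds the weights from below. *)
Lemma arithmetic_harmonic_ratio_lt (c : R) : 0 < c -> (forall i, c <= alpha i) ->
  a / h < c * expR 1 * (a / g) `^ (1 / c) + 1.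
Proof.
move=> c0 calpha.
have a0 := weighted_arithmetic_mean_gt0; have g0 := weighted_geometric_mean_gt0.
pose u i := x i / a; have u0 i : 0 < u i by rewrite divr_gt0.
have e0 : 0 < expR 1 :> R := expR_gt0 1.
have := @ge1D_expR_sum R 'I_n (fun i => alpha i / c)
  (fun i => (u i + (u i)^-1 - 2) / expR 1) (fun i => u i - 1 - ln (u i)).
have -> : \sum_i alpha i / c * (u i - 1 - ln (u i)) = ln (a / g) * (1 / c).
  under eq_bigr do rewrite mulrAC 2!mulrBr mulr1.
  rewrite -mulr_suml 2!sumrB sum_weighted_ratio sum_alpha.
  by rewrite sum_weighted_log_ratio subrr sub0r -lnV ?posrE ?divr_gt0// invf_div mul1r.
have -> : \sum_i alpha i / c * ((u i + (u i)^-1 - 2) / expR 1) =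
    (a / h - 1) / (c * expR 1).
  under eq_bigr do
    rewrite mulrACA -invfM mulrBr mulrDr.
  rewrite -mulr_suml sumrB big_split /= -mulr_suml sum_weighted_ratio.
  by rewrite sum_alpha sum_weighted_inv_ratio; congr (_ / _); ring.
rewrite expRM lnK ?posrE ?divr_gt0// => key.
rewrite -ltrBlDr [ltRHS]mulrC -ltr_pdivrMr ?mulr_gt0//.
(* Strictness comes for free from the summand [1] in [key]. *)
apply: (lt_le_trans _ (key _ _ _)); first by rewrite ltrDr.
- by move=> i; rewrite ler_pdivlMr// mul1r.
- move=> i; rewrite divr_ge0 ?(ltW e0)//.
  have -> : u i + (u i)^-1 - 2 = (1 - u i) ^+ 2 / u i by field; rewrite gt_eqF.
  by rewrite divr_ge0 ?sqr_ge0 ?(ltW (u0 i)).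
- by move=> i; exact: ge1D_expR_gap.
Qed.

(** With [P = (a / g) ^ (1 / c) >= 1] the core estimate gives
    [a / h < c e P + 1 <= (e / 2 + 1) P <= e P], and [e <= expR (h / a + K)];
    raising the resulting bound on [1 / P] to the power [c] isolates [g / a]. *)
Lemma geometric_lt_arithmetic_mean (c K : R) :
  0 < c <= 2^-1 -> (forall i, c <= alpha i) -> 1 <= K ->
  g < a * (h / a * expR (h / a + K)) `^ c.
Proof.
move=> /andP[c0 c2] calpha K1.
have a0 := weighted_arithmetic_mean_gt0; have g0 := weighted_geometric_mean_gt0.
have h0 := weighted_harmonic_mean_gt0.
have ha0 : 0 < h / a by rewrite divr_gt0.
have ag0 : 0 < a / g by rewrite divr_gt0.
have P0 := powR_gt0 (1 / c) ag0.
have P1 : 1 <= (a / g) `^ (1 / c).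
  rewrite -[leLHS](powRr0 (a / g)) ler_powR ?divr_ge0 ?(ltW c0)//.
  by rewrite ler_pdivlMr// mul1r weighted_geometric_le_arithmetic_mean.
have H : a / h < (a / g) `^ (1 / c) * expR (h / a + K).
  apply: (lt_le_trans (arithmetic_harmonic_ratio_lt c0 calpha)).
  have eE : expR 1 <= expR (h / a + K) by rewrite ler_expR; lra.
  apply: le_trans (ler_wpM2l (ltW P0) eE).
  have := expR1_ge2 R; set e := expR 1 => e2; set P := _ `^ _ in P0 P1 *.
  have : 0 <= (2^-1 - c) * e * P by rewrite !mulr_ge0//; lra.
  have : 0 <= (e - 2) * P by rewrite mulr_ge0//; lra.
  by lra.
have {}H : ((a / g) `^ (1 / c))^-1 < h / a * expR (h / a + K).
  have E0 : 0 < expR (h / a + K) := expR_gt0 _.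
  have lt_inv := @invf_plt R ((a / g) `^ (1 / c)) (h / a * expR (h / a + K)).
  rewrite lt_inv ?posrE//; last exact: mulr_gt0.
  by rewrite invfM invf_div ltr_pdivrMr.
have lhs_ge0 : ((a / g) `^ (1 / c))^-1 \in Num.nneg by rewrite nnegrE invr_ge0 ltW.
have rhs_ge0 : h / a * expR (h / a + K) \in Num.nneg.
  by rewrite nnegrE mulr_ge0 ?(ltW ha0) ?expR_ge0.
have := gt0_ltr_powR c0 lhs_ge0 rhs_ge0 H.
rewrite -powRN -powRrM mulNr divfK ?gt_eqF// powR_inv1 ?(ltW ag0)//.
by rewrite invf_div ltr_pdivrMr// mulrC.
Qed.

End means.

(** * Duality under inversion *)

Section duality.
Context (R : realType) (n : nat) (alpha x : 'I_n -> R).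
Hypothesis x_gt0 : forall i, 0 < x i.

Lemma weighted_arithmetic_meanV :
  weighted_arithmetic_mean alpha (fun i => (x i)^-1) =
  (weighted_harmonic_mean alpha x)^-1.
Proof. by rewrite /weighted_harmonic_mean invrK. Qed.

Lemma weighted_harmonic_meanV :
  weighted_harmonic_mean alpha (fun i => (x i)^-1) =
  (weighted_arithmetic_mean alpha x)^-1.
Proof.
by congr (_^-1); apply: eq_bigr => i _; rewrite invrK.
Qed.

Lemma weighted_geometric_meanV :
  weighted_geometric_mean alpha (fun i => (x i)^-1) =
  (weighted_geometric_mean alpha x)^-1.
Proof.
rewrite !weighted_geometric_meanE//; last by move=> i; rewrite invr_gt0.
rewrite -expRN -sumrN; congr expR; apply: eq_bigr => i _.
by rewrite lnV ?posrE// mulrN.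
Qed.

End duality.

(** * Bounds between the three means *)

Theorem corollary2p2 (R : realType) (n : nat) (alpha x : 'I_n -> R)
    (alpha_gt0 : forall i, 0 < alpha i) (x_gt0 : forall i, 0 < x i)
    (sum_alpha : \sum_(i < n) alpha i = 1)
    (x_not_const : ~ (forall i j, x i = x j)) :
  let h := weighted_harmonic_mean alpha x in
  let g := weighted_geometric_mean alpha x in
  let a := weighted_arithmetic_mean alpha x in
  let al := min_weight alpha in
  let e := expR 1 : R in
  let q := h / a * expR (h / a + n%:R / (n%:R - 1)) in
  [/\ a * (al * e * (a / g) `^ (1 / al) + 1)^-1 < h,
      h <= g,
      g <= a &
      a < h * (al * e * (g / h) `^ (1 / al) + 1)]
  /\
  h * q `^ (- al) < g /\ g < a * q `^ al.
Proof.
move=> h g a al e q.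
have xV0 i : 0 < (x i)^-1 by rewrite invr_gt0.
have a0 : 0 < a by exact: weighted_arithmetic_mean_gt0.
have g0 : 0 < g by exact: weighted_geometric_mean_gt0.
have h0 : 0 < h by exact: weighted_harmonic_mean_gt0.
have al_gt0 : 0 < al by apply: lt_bigmin => // i _; exact: alpha_gt0.
have al_le i : al <= alpha i by exact: bigmin_le.
have [i [j ij]] : exists i j : 'I_n, i != j.
  apply: contrapT => nij; apply: x_not_const => i j; congr x.
  by apply/eqP/negPn/negP => ij; apply: nij; exists i, j.
have n2 : (1 < n)%N.
  have := ltn_ord i; have := ltn_ord j; move: ij; rewrite -val_eqE /=; lia.
have al_half : 0 < al <= 2^-1.
  rewrite al_gt0 /=; suff : alpha i + alpha j <= 1.
    by have := al_le i; have := al_le j; lra.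
  rewrite -sum_alpha (bigD1 i)//= lerD2l (bigD1 j) 1?eq_sym//= lerDl.
  by apply: sumr_ge0 => k _; exact/ltW.
have K1 : 1 <= n%:R / (n%:R - 1) :> R.
  have n1 : 0 < n%:R - 1 :> R by rewrite subr_gt0 ltr1n.
  by rewrite ler_pdivlMr// mul1r gerBl.
have q0 : 0 < q by rewrite mulr_gt0 ?divr_gt0 ?expR_gt0.
have ratioV (y z : R) : y^-1 / z^-1 = z / y by rewrite invrK mulrC.
split; first split.
- have H := arithmetic_harmonic_ratio_lt alpha_gt0 x_gt0 sum_alpha al_gt0 al_le.
  rewrite ltr_pdivrMr; last by apply: lt_trans H; exact: divr_gt0.
  by rewrite mulrC -ltr_pdivrMr.
- have := weighted_geometric_le_arithmetic_mean alpha_gt0 xV0 sum_alpha.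
  by rewrite weighted_geometric_meanV// weighted_arithmetic_meanV lef_pV2 ?posrE.
- exact: weighted_geometric_le_arithmetic_mean.
- have := arithmetic_harmonic_ratio_lt alpha_gt0 xV0 sum_alpha al_gt0 al_le.
  rewrite weighted_geometric_meanV// weighted_arithmetic_meanV.
  rewrite weighted_harmonic_meanV -/h -/g -/a !ratioV.
  by rewrite ltr_pdivrMr// [X in _ < X]mulrC.
- have H := geometric_lt_arithmetic_mean alpha_gt0 x_gt0 sum_alpha al_half al_le K1.
  split=> //.
  have := geometric_lt_arithmetic_mean alpha_gt0 xV0 sum_alpha al_half al_le K1.
  rewrite weighted_geometric_meanV// weighted_arithmetic_meanV.
  rewrite weighted_harmonic_meanV -/h -/g -/a ratioV -/q => Hv.
  have rhs_gt0 : 0 < h^-1 * q `^ al by apply: lt_trans Hv; rewrite invr_gt0.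
  have : (h^-1 * q `^ al)^-1 < g by rewrite -[g]invrK ltf_pV2 ?posrE ?invr_gt0.
  by rewrite invfM invrK powRN.
Qed.
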